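(* Let $A$ be a finite set of agents. A formula $\phi\in\mathcal{L}(A)$ is valid on all standard models (i.e. $\mathbf{S5}\mathsf{G}^{\mathsf{c}}_{\mathsf{inv}}$-valid) if and only if it is $\mathsf{eF}$-valid.
   Context: Fix a countable set $\mathrm{Prop}$ of propositional variables and a finite set $A$ of agents. $\mathcal{L}(A)$ is the set of formulas $\phi ::= p \mid {\sim}\phi \mid (\phi\wedge\phi)\mid(\phi\to\phi)\mid \Box_a\phi$ with $p\in\mathrm{Prop}$, $a\in A$. An epistemic frame for $A$ is a tuple $\langle W,\langle R_a\rangle_{a\in A}\rangle$ with $W\neq\varnothing$ and each $R_a$ an equivalence relation on $W$. Standard semantics. An $\mathbf{S5}\mathsf{G}^{\mathsf{c}}_{\mathsf{inv}}$-model (standard model) for $A$ is an epistemic frame for $A$ together with a valuation $v:\mathrm{Prop}\times W\to[0,1]$, extended to formulas by $v({\sim}\phi,w)=1-v(\phi,w)$; $v(\phi\wedge\chi,w)=\min(v(\phi,w),v(\chi,w))$; $v(\phi\to\chi,w)=1$ if $v(\phi,w)\le v(\chi,w)$ and $v(\chi,w)$ otherwise; $v(\Box_a\phi,w)=\inf\{v(\phi,w')\mid wR_aw'\}$. A formula $\phi$ is $\mathbf{S5}\mathsf{G}^{\mathsf{c}}_{\mathsf{inv}}$-valid if $v(\phi,w)=1$ for every standard model for $A$ and every state $w$ in it. $\mathsf{eF}$-semantics. An $\mathsf{eF}$-model for $A$ is a tuple $M=\langle W,\langle R_a\rangle_{a\in A},\langle T_a\rangle_{a\in A},v\rangle$ where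 $\langle W,\langle R_a\rangle_{a\in A}\rangle$ is an epistemic frame, $v:\mathrm{Prop}\times W\to[0,1]$, and each $T_a$ maps $W$ to finite subsets of $[0,1]$ so that (i) $\{0,\frac12,1\}\subseteq T_a(w)$ for all $w\in W$; (ii) $x\in T_a(w)$ implies $1-x\in T_a(w)$; (iii) $wR_aw'$ implies $T_a(w)=T_a(w')$. The valuation extends to propositional connectives as in the standard semantics and $v(\Box_a\phi,w)=\max\{x\in T_a(w)\mid x\le\inf\{v(\phi,w')\mid wR_aw'\}\}$. A formula $\phi$ is $\mathsf{eF}$-valid if $v(\phi,w)=1$ for every $\mathsf{eF}$-model for $A$ and every state $w$ in it. *)

(* Defs.v *)
From Stdlib Require Export RelationClasses.
From HB Require Import structures.
From mathcomp Require Export all_boot all_order all_algebra finmap.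
From mathcomp Require Export boolp classical_sets reals.

Set Implicit Arguments.
Unset Strict Implicit.
Unset Printing Implicit Defensive.

Import Order.TTheory GRing.Theory Num.Theory.

Local Open Scope classical_set_scope.
Local Open Scope ring_scope.

Inductive formula (Var : countType) (A : finType) : Type :=
| FVar of Var
| FNeg of formula Var A
| FAnd of formula Var A & formula Var A
| FImp of formula Var A & formula Var A
| FBox of A & formula Var A.

Record epistemic_frame (A : finType) := EpistemicFrame {
  state :> Type;
  state_inhabited : inhabited state;
  acc : A -> state -> state -> Prop;
  acc_equivalence : forall a, Equivalence (acc a)
}.

Section Semantics.
Context {R : realType} {Var : countType} {A : finType}.

(* Goedel implication *)
Definition goedel_imp (x y : R) : R := if x <= y then 1 else y.

(* The two semantics differ only in the clause for boxes, so the extension of a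
   valuation is parametrised by the interpretation [box] of the modalities as
   operators on [0,1]-valued functions of states. *)
Fixpoint extend (W : Type) (box : A -> (W -> R) -> W -> R)
    (v : Var -> W -> R) (phi : formula Var A) : W -> R :=
  match phi with
  | FVar p => v p
  | FNeg psi => fun w => 1 - extend box v psi w
  | FAnd psi chi => fun w => Num.min (extend box v psi w) (extend box v chi w)
  | FImp psi chi => fun w => goedel_imp (extend box v psi w) (extend box v chi w)
  | FBox a psi => box a (extend box v psi)
  end.

Definition inf_acc (F : epistemic_frame A) (a : A) (f : F -> R) (w : F) : R :=
  inf [set f w' | w' in [set w' : F | acc a w w']].

End Semantics.

Record std_model (R : realType) (Var : countType) (A : finType) := StdModel {
  std_frame :> epistemic_frame A;
  std_val : Var -> std_frame -> R;
  std_val01 : forall p w, 0 <= std_val p w <= 1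
}.

Definition std_eval (R : realType) (Var : countType) (A : finType)
    (M : std_model R Var A) (phi : formula Var A) (w : M) : R :=
  extend (@inf_acc R A M) (@std_val R Var A M) phi w.

Definition std_valid (R : realType) (Var : countType) (A : finType)
    (phi : formula Var A) : Prop :=
  forall (M : std_model R Var A) (w : M), std_eval phi w = 1.

Record eF_model (R : realType) (Var : countType) (A : finType) := EFModel {
  eF_frame :> epistemic_frame A;
  eF_T : A -> eF_frame -> {fset R};
  eF_val : Var -> eF_frame -> R;
  eF_T01 : forall a w x, x \in eF_T a w -> 0 <= x <= 1;
  eF_T_base : forall a w,
    [/\ 0 \in eF_T a w, 2^-1 \in eF_T a w & 1 \in eF_T a w];
  eF_T_compl : forall a w x, x \in eF_T a w -> 1 - x \in eF_T a w;
  eF_T_acc : forall a w w', acc a w w' -> eF_T a w = eF_T a w';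
  eF_val01 : forall p w, 0 <= eF_val p w <= 1
}.

(* The default value 0 of the iterated maximum is harmless: 0 is itself in
   [eF_T a w] and below the infimum, so this is a maximum of a nonempty finite
   set; see [eF_box_max]. *)
Definition eF_box (R : realType) (Var : countType) (A : finType)
    (M : eF_model R Var A) (a : A) (f : M -> R) (w : M) : R :=
  \big[Num.max/0]_(x <- eF_T a w | x <= inf_acc a f w) x.

Definition eF_eval (R : realType) (Var : countType) (A : finType)
    (M : eF_model R Var A) (phi : formula Var A) (w : M) : R :=
  extend (@eF_box R Var A M) (@eF_val R Var A M) phi w.

Definition eF_valid (R : realType) (Var : countType) (A : finType)
    (phi : formula Var A) : Prop :=
  forall (M : eF_model R Var A) (w : M), eF_eval phi w = 1.

Section Sanity.
Context {R : realType} {Var : countType} {A : finType}.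

Lemma inf_acc01 (F : epistemic_frame A) (a : A) (f : F -> R) (w : F) :
  (forall w', 0 <= f w' <= 1) -> 0 <= inf_acc a f w <= 1.
Proof.
move=> f01; have [rfl _ _] := acc_equivalence F a.
have lb0 : lbound [set f w' | w' in [set w' : F | acc a w w']] 0.
  by move=> _ [w' _ <-]; have /andP[] := f01 w'.
apply/andP; split.
  by apply: lb_le_inf => //; exists (f w), w => //; exact: rfl.
apply: (@le_trans _ _ (f w)); last by have /andP[] := f01 w.
by apply: ge_inf; [exists 0 | exists w => //; exact: rfl].
Qed.

Lemma eF_box_max (M : eF_model R Var A) (a : A) (f : M -> R) (w : M) :
  (forall w', 0 <= f w' <= 1) ->
  [/\ eF_box a f w \in eF_T a w, eF_box a f w <= inf_acc a f w &
      forall x, x \in eF_T a w -> x <= inf_acc a f w -> x <= eF_box a f w].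
Proof.
move=> f01; have /andP[i0 _] := inf_acc01 a w f01.
have [T0 _ _] := eF_T_base a w.
have : (eF_box a f w \in eF_T a w) && (eF_box a f w <= inf_acc a f w).
  rewrite /eF_box big_seq_cond.
  apply: (big_ind (fun y => (y \in eF_T a w) && (y <= inf_acc a f w))) => //.
    by rewrite T0 i0.
  by move=> x y px py; rewrite /Num.max; case: ifP.
case/andP=> hT hi; split=> // x xT xi.
exact: (@bigmax_sup_seq _ _ _ (eF_T a w) 0 x (fun y => y <= inf_acc a f w) x id).
Qed.

Lemma extend01 (W : Type) (box : A -> (W -> R) -> W -> R)
    (v : Var -> W -> R) (phi : formula Var A) (w : W) :
  (forall a f w, (forall w', 0 <= f w' <= 1) -> 0 <= box a f w <= 1) ->
  (forall p w, 0 <= v p w <= 1) -> 0 <= extend box v phi w <= 1.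
Proof.
move=> box01 v01; elim: phi w => //= [psi IH|psi IH1 chi IH2|psi IH1 chi IH2|a psi IH] w.
- by have /andP[h0 h1] := IH w; rewrite subr_ge0 h1 lerBlDr lerDl.
- by rewrite /Num.min; case: ifP.
- by rewrite /goedel_imp; case: ifP => // _; rewrite ler01 lexx.
- exact: box01.
Qed.

Lemma std_eval01 (M : std_model R Var A) (phi : formula Var A) (w : M) :
  0 <= std_eval phi w <= 1.
Proof.
by apply: extend01; [move=> a f w'; apply: inf_acc01 | exact: std_val01].
Qed.

Lemma eF_eval01 (M : eF_model R Var A) (phi : formula Var A) (w : M) :
  0 <= eF_eval phi w <= 1.
Proof.
apply: extend01; last exact: eF_val01.
by move=> a f w' /(eF_box_max a w')[/eF_T01].
Qed.

End Sanity.

(* Main.v *)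
Require Import Defs.
From mathcomp Require Import lra.

Set Implicit Arguments.
Unset Strict Implicit.
Unset Printing Implicit Defensive.

Import Order.TTheory GRing.Theory Num.Theory.

Local Open Scope classical_set_scope.
Local Open Scope ring_scope.

(** Each direction turns a countermodel for one semantics into a countermodel
    for the other.

    From a standard model to an eF-model: frame and valuation are kept. Only
    finitely many boxed formulas occur in [phi], so the values that they take at
    [w], with 0, 1/2 and 1, closed under [x |-> 1 - x], form a legitimate [T_a(w)]. Rounding an
    infimum down to this set is then harmless, because every infimum met in the
    evaluation of [phi] already belongs to the set ([eF_of_std_eval]).

    From an eF-model to a standard model: the rounding has to be produced by
    genuine infima. The connectives cannot see more of the unit interval than
    its order, its top and the involution [x |-> 1 - x], so all truth values may
    be transported along a _rescaling_, a strictly increasing map that fixes 1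
    and commutes with the involution. A state of the new model is a state [w]
    together with a rescaling [g], and a formula of value [x] at [w] has value
    [g x] at [(w, g)]. Agent [a] relates [(w, g)] to [(w', g')] when it relates
    [w] to [w'] and [g], [g'] agree on [T_a(w)]; this is an equivalence because
    [T_a(w) = T_a(w')]. Let [t] be the value of [Box_a psi] at [w]. Along the
    class of [(w, g)] no value of [psi] falls below [g t], because its
    values in the class of [w] are at least [t] and the rescalings of the class
    agree at [t]. On the other hand, if [t < 1], some [w'] in the class of
    [w] gives [psi] a value strictly below the next element of [T_a(w)], and a
    rescaling may contract that gap of [T_a(w)] towards its lower end while
    moving no point of [T_a(w)] ([rescaling_gap]). The infimum is therefore
    exactly [g t] ([inf_acc_rescaled]), and induction on formulas gives the
    claim ([std_of_eF_eval]). Agents with different sets [T_a] do not interfere,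
    because the rescaling is part of the state. *)

(** * Infima over indistinguishability classes *)

Section Infima.
Context {R : realType} {Var : countType} {A : finType}.

Lemma inf_acc_congr (F : epistemic_frame A) a (f : F -> R) (w w' : F) :
  acc a w w' -> inf_acc a f w = inf_acc a f w'.
Proof.
move=> ww'; have [_ sym trans] := acc_equivalence F a.
rewrite /inf_acc; congr inf; apply/seteqP.
split=> _ [u wu <-]; exists u => //; first exact: trans (sym _ _ ww') wu.
exact: trans ww' wu.
Qed.

Lemma eF_box_inf (M : eF_model R Var A) a (f : M -> R) w :
  (forall w', 0 <= f w' <= 1) -> inf_acc a f w \in eF_T a w ->
  eF_box a f w = inf_acc a f w.
Proof.
move=> f01 fT; have [_ le_inf max] := eF_box_max a w f01.
by apply/le_anti; rewrite le_inf max.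
Qed.

End Infima.

(** * From standard models to eF-models *)

Section FromStandard.
Context {R : realType} {Var : countType} {A : finType} (M : std_model R Var A).

Fixpoint box_values (phi : formula Var A) (a : A) (w : M) : seq R :=
  match phi with
  | FVar _ => [::]
  | FNeg psi => box_values psi a w
  | FAnd psi chi | FImp psi chi => box_values psi a w ++ box_values chi a w
  | FBox b psi =>
      (if b == a then [:: std_eval (FBox b psi) w] else [::])
      ++ box_values psi a w
  end.

Lemma box_values01 phi a w x : x \in box_values phi a w -> 0 <= x <= 1.
Proof.
elim: phi => //= [psi IH chi IH'|psi IH chi IH'|b psi IH];
  rewrite mem_cat => /orP[]; [exact: IH|exact: IH'|exact: IH|exact: IH'| |exact: IH].
by case: ifP => // _; rewrite inE => /eqP->; exact: std_eval01.
Qed.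

(** What makes [box_values] eligible as a set [T_a]: a box of agent [a] is an
    infimum over the whole class of [w]. *)
Lemma box_values_acc phi a w w' :
  acc a w w' -> box_values phi a w = box_values phi a w'.
Proof.
move=> ww'; elim: phi => //= [psi -> chi -> //|psi -> chi -> //|b psi ->].
by case: eqP => // ->; rewrite /std_eval /= (inf_acc_congr _ ww').
Qed.

Definition landmarks (phi : formula Var A) (a : A) (w : M) : seq R :=
  [:: 1, 2^-1 & box_values phi a w].

Definition landmark_set (phi : formula Var A) (a : A) (w : M) : {fset R} :=
  [fset x in landmarks phi a w ++ [seq 1 - x | x <- landmarks phi a w]]%fset.

Lemma landmark_setP phi a w x :
  x \in landmark_set phi a w =
  (x \in landmarks phi a w) || (1 - x \in landmarks phi a w).
Proof.
rewrite in_fset [LHS](@mem_cat R x (landmarks phi a w)); congr (_ || _).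
by apply/mapP/idP => [[y yl ->]|xl]; [rewrite subKr|exists (1 - x); rewrite ?subKr].
Qed.

Lemma landmarks01 phi a w x : x \in landmarks phi a w -> 0 <= x <= 1.
Proof. by rewrite !inE => /or3P[/eqP->|/eqP->|/box_values01//]; lra. Qed.

Lemma landmark_set01 phi a w x : x \in landmark_set phi a w -> 0 <= x <= 1.
Proof. by rewrite landmark_setP => /orP[] /landmarks01; lra. Qed.

Lemma landmark_set_base phi a w :
  [/\ 0 \in landmark_set phi a w, 2^-1 \in landmark_set phi a w &
      1 \in landmark_set phi a w].
Proof. by rewrite !landmark_setP !inE subr0 !eqxx !orbT. Qed.

Lemma landmark_set_compl phi a w x :
  x \in landmark_set phi a w -> 1 - x \in landmark_set phi a w.
Proof. by rewrite !landmark_setP subKr orbC. Qed.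

Lemma landmark_set_acc phi a w w' :
  acc a w w' -> landmark_set phi a w = landmark_set phi a w'.
Proof. by move=> ww'; rewrite /landmark_set /landmarks (box_values_acc _ ww'). Qed.

Definition eF_of_std (phi : formula Var A) : eF_model R Var A :=
  EFModel (@landmark_set01 phi) (@landmark_set_base phi)
    (@landmark_set_compl phi) (@landmark_set_acc phi) (@std_val01 _ _ _ M).

Lemma eF_of_std_eval phi w : @eF_eval _ _ _ (eF_of_std phi) phi w = std_eval phi w.
Proof.
have sub a u : {subset box_values phi a u <= landmark_set phi a u}.
  by move=> x xb; rewrite landmark_setP !inE xb !orbT.
(* The sets [T_a] come from [phi] throughout, so the induction runs over
   formulas whose boxes are among those of [phi]. *)
suff gen psi : (forall a u, {subset box_values psi a u <= landmark_set phi a u}) ->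
    forall u, extend (@eF_box _ _ _ (eF_of_std phi)) (@std_val _ _ _ M) psi u =
              extend (@inf_acc R A M) (@std_val _ _ _ M) psi u by exact: gen.
elim: psi {w sub} => //= [psi IH|psi IH chi IH'|psi IH chi IH'|b psi IH] sub u.
- by rewrite IH.
- by rewrite IH ?IH' // => a v x xv; apply: sub; rewrite mem_cat xv ?orbT.
- by rewrite IH ?IH' // => a v x xv; apply: sub; rewrite mem_cat xv ?orbT.
rewrite (_ : extend _ _ psi = std_eval psi); last first.
  by apply/funext; apply: IH => a v x xv; apply: sub; rewrite mem_cat xv orbT.
apply: (@eF_box_inf _ _ _ (eF_of_std phi)) => [v|]; first exact: std_eval01.
by apply: sub; rewrite mem_cat eqxx inE eqxx.
Qed.

End FromStandard.

(** * Rescalings of the truth values *)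

Section Rescaling.
Context {R : realType}.

(** Order, top and involution are what the propositional connectives see of the
    truth values. Jumps are allowed, so that the gaps of a finite set can be
    contracted piecewise linearly; [g 0 = 0] follows from the other clauses. *)
Definition rescaling (g : R -> R) : Prop :=
  [/\ {homo g : x y / x < y}, g 1 = 1 & forall x, g (1 - x) = 1 - g x].

Lemma rescaling_le g : rescaling g -> {mono g : x y / x <= y}.
Proof. by case=> /le_mono. Qed.

Lemma rescaling_lt g : rescaling g -> {mono g : x y / x < y}.
Proof. by move=> /rescaling_le/leW_mono. Qed.

Lemma rescaling01 g x : rescaling g -> 0 <= x <= 1 -> 0 <= g x <= 1.
Proof.
move=> gr /andP[x0 x1]; have [_ g1 gN] := gr.
have g0 : g 0 = 0 by rewrite -(subrr 1) gN g1 subrr.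
by apply/andP; split; [rewrite -g0|rewrite -g1]; rewrite (rescaling_le gr).
Qed.

Lemma rescaling_id : rescaling id.
Proof. by split. Qed.

Lemma rescaling_comp h g : rescaling h -> rescaling g -> rescaling (h \o g).
Proof.
move=> [hm h1 hN] [gm g1 gN]; split=> /= [x y xy||x].
- exact/hm/gm.
- by rewrite g1.
- by rewrite gN hN.
Qed.

(** Contracts the gap [(s, s')] towards [s] by the factor [d]. The reflected gap
    [(1 - s', 1 - s)] is contracted towards [1 - s], as commuting with the
    involution forces; the map may jump at the other ends of the two gaps. *)
Definition squeeze (s s' d y : R) : R :=
  if s < y < s' then s + d * (y - s)
  else if s < 1 - y < s' then 1 - (s + d * (1 - y - s))
  else y.

(** A gap lying on one side of [1/2] is disjoint from its reflection, so the two
    contractions do not conflict. *)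
Lemma rescaling_squeeze s s' d : 0 <= s -> s < s' <= 2^-1 \/ 2^-1 <= s < s' ->
  s' <= 1 -> 0 < d <= 1 -> rescaling (squeeze s s' d).
Proof.
move=> s0 side s'1 d01.
(* After this bound and [pm], [pm'] the products with [d] can be treated as
   unknowns, and the case analysis is linear. *)
have piece y : s < y -> s < s + d * (y - s) <= y by move=> sy; nra.
rewrite /squeeze; split=> [x y xy||x].
- have px := piece x; have py := piece y.
  have px' := piece (1 - x); have py' := piece (1 - y).
  have pm : d * (x - s) < d * (y - s) by nra.
  have pm' : d * (1 - y - s) < d * (1 - x - s) by nra.
  move: (d * (x - s)) (d * (y - s)) (d * (1 - x - s)) (d * (1 - y - s))
    px py px' py' pm pm' => dx dy dx' dy' px py px' py' pm pm'.
  by do ?[case: ifPn => ?]; lra.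
- by do ?[case: ifPn => ?]; lra.
- rewrite subKr; case: ifPn => ?; case: ifPn => ?; lra.
Qed.

Lemma rescaling_min g x y :
  rescaling g -> g (Num.min x y) = Num.min (g x) (g y).
Proof. by move=> gr; rewrite /Order.min (rescaling_lt gr); case: ifP. Qed.

Lemma rescaling_goedel_imp g x y :
  rescaling g -> g (goedel_imp x y) = goedel_imp (g x) (g y).
Proof.
move=> gr; have [_ g1 _] := gr.
by rewrite /goedel_imp (rescaling_le gr); case: ifP.
Qed.

(** A value [x] in a gap of [T] can be brought arbitrarily close to the image of
    the lower end [t] of the gap, without disturbing the images of [T]. The
    membership of [1/2] in [T] keeps the gap on one side of [1/2], and the
    symmetry of [T] keeps [T] out of the reflected gap. *)
Lemma rescaling_gap (T : {fset R}) g t t' x e :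
  (forall u, u \in T -> 1 - u \in T) -> 2^-1 \in T ->
  (forall u, u \in T -> t < u -> t' <= u) ->
  rescaling g -> 0 <= t -> t' <= 1 -> t <= x < t' -> 0 < e ->
  exists g', [/\ rescaling g', {in T, g' =1 g} & g' x < g t + e].
Proof.
move=> TN Thalf gap gr t0 t'1 /andP[tx xt'] e0.
case: (ltgtP t x) tx => // [tx _|<- _]; last by exists g; split=> //; lra.
have [_ g1 gN] := gr.
have ghalf : g 2^-1 = 2^-1.
  by have := gN 2^-1; rewrite (_ : 1 - 2^-1 = 2^-1 :> R); lra.
have gt0 : 0 <= g t.
  by have /andP[] : 0 <= g t <= 1 by apply: rescaling01 gr _; lra.
have gt'1 : g t' <= 1 by rewrite -g1 (rescaling_le gr).
have gtx : g t < g x by rewrite (rescaling_lt gr).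
have gxt' : g x < g t' by rewrite (rescaling_lt gr).
have side : g t < g t' <= 2^-1 \/ 2^-1 <= g t < g t'.
  rewrite -ghalf !(rescaling_le gr) !(rescaling_lt gr).
  by case: (ltP t 2^-1) => [/(gap _ Thalf)|] ?; [left|right]; lra.
(* [g x - g t < 1], so a contraction by [d <= e] brings it below [e]. *)
pose d := Num.min 1 e.
have d01 : 0 < d <= 1 by rewrite lt_min ge_min lexx e0 ltr01.
have de : d <= e by rewrite ge_min lexx orbT.
(* The squeezing is done after [g], on the image of the gap. *)
exists (squeeze (g t) (g t') d \o g); split.
- by apply: rescaling_comp => //; apply: rescaling_squeeze.
- move=> u uT /=.
  have out v : v \in T -> (g t < g v < g t') = false.
    move=> vT; rewrite !(rescaling_lt gr).
    by apply/negP => /andP[/(gap _ vT)]; lra.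
  by rewrite /squeeze -gN !out // TN.
- by rewrite /= /squeeze gtx gxt' /=; nra.
Qed.

End Rescaling.

(** * From eF-models to standard models *)

Section FromEF.
Context {R : realType} {Var : countType} {A : finType} (M : eF_model R Var A).

Definition rescaled_state : Type := M * {g : R -> R | rescaling g}.

Definition rescaled_acc (a : A) (p q : rescaled_state) : Prop :=
  acc a p.1 q.1 /\ {in eF_T a p.1, sval p.2 =1 sval q.2}.

Lemma rescaled_acc_equivalence a : Equivalence (rescaled_acc a).
Proof.
have [refl sym trans] := acc_equivalence M a; split.
- by move=> p; split.
- move=> p q [pq gh]; split; first exact: sym.
  by rewrite -(eF_T_acc pq) => u uT; rewrite gh.
- move=> p q r [pq gh] [qr hk]; split; first exact: trans qr.
  by move=> u uT; rewrite gh // hk // -(eF_T_acc pq).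
Qed.

Lemma rescaled_inhabited : inhabited rescaled_state.
Proof.
by have [w] := state_inhabited M; split; exact: (w, exist _ id rescaling_id).
Qed.

Definition rescaled_frame : epistemic_frame A :=
  EpistemicFrame rescaled_inhabited rescaled_acc_equivalence.

Definition rescaled_val (x : Var) (p : rescaled_frame) : R :=
  sval p.2 (eF_val x p.1).

Lemma rescaled_val01 x p : 0 <= rescaled_val x p <= 1.
Proof. exact: rescaling01 (proj2_sig p.2) (eF_val01 _ _). Qed.

Definition std_of_eF : std_model R Var A := StdModel rescaled_val01.

(** The rounding down to [T_a(w)] is realised by an infimum: members of the class
    of [(w, g)] are pinned on [T_a(w)] and free inside its gaps. *)
Lemma inf_acc_rescaled a (f : M -> R) (w : M) (g : {g | rescaling g}) :
  (forall w', 0 <= f w' <= 1) ->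
  @inf_acc R A rescaled_frame a (fun p => sval p.2 (f p.1)) (w, g) =
  sval g (eF_box a f w).
Proof.
move=> f01; have [tT ti max] := eF_box_max a w f01.
have [refl _ _] := acc_equivalence rescaled_frame a.
have [acc_refl _ _] := acc_equivalence M a.
set t := eF_box a f w in tT ti max *.
have f_inf w' : acc a w w' -> inf_acc a f w <= f w'.
  move=> ww'; apply: ge_inf; last by exists w'.
  by exists 0 => _ [u _ <-]; have /andP[] := f01 u.
set S := [set (fun p : rescaled_state => sval p.2 (f p.1)) w' |
          w' in [set w' | rescaled_acc a (w, g) w']].
have S_lb : lbound S (sval g t).
  move=> _ [[w' h] [/= ww' gh] <-] /=.
  rewrite gh // (rescaling_le (proj2_sig h)).
  exact: le_trans ti (f_inf _ ww').
have S0 : S !=set0 by exists (sval g (f w)), (w, g) => //; exact: refl.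
apply/le_anti/andP; split; last exact: lb_le_inf.
have [_ Thalf T1] := eF_T_base a w.
have t01 := eF_T01 tT.
have S_inf p : rescaled_acc a (w, g) p -> inf S <= sval p.2 (f p.1).
  by move=> wp; apply: ge_inf; [exists (sval g t)|exists p].
(* If [t = 1] there is no gap above [t], but then [f w = 1]. *)
have [t1|t1] := ltP t 1; last first.
  have -> : t = f w.
    have := f_inf w (acc_refl w); have := f01 w; lra.
  exact: (S_inf (w, g) (refl _)).
(* The next element of [T_a(w)] above [t]; as [t < 1], the default value 1
   is itself one of the candidates. *)
pose t' := \big[Num.min/1]_(u <- eF_T a w | t < u) u.
have gap u : u \in eF_T a w -> t < u -> t' <= u.
  by move=> uT tu; exact: (@ge_bigmin_seq _ _ _ _ _ u _ id).
have it' : inf_acc a f w < t'.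
  have above u : u \in eF_T a w -> t < u -> inf_acc a f w < u.
    by move=> uT; rewrite !ltNge; apply: contra; exact: max.
  rewrite /t' big_seq_cond; apply: lt_bigmin; first exact: above.
  by move=> u /andP[]; exact: above.
have [|_ [w' ww' <-] fw't'] := inf_lt _ it'.
  by exists (f w), w => //; exact: acc_refl.
apply/ler_addgt0Pr => e e0.
have [h [hr hg he]] : exists h, [/\ rescaling h, {in eF_T a w, h =1 sval g} &
    h (f w') < sval g t + e].
  apply: (rescaling_gap (t' := t')) Thalf gap (proj2_sig g) _ _ _ e0.
  - by move=> u; exact: eF_T_compl.
  - by case/andP: t01.
  - exact: bigmin_le_id.
  - by rewrite fw't' (le_trans ti) // f_inf.
apply: le_trans (ltW he); apply: (S_inf (w', exist _ h hr)).
by split=> //= u uT; rewrite hg.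
Qed.

(** At [g = id] the new model reproduces the values of the eF-model; arbitrary
    [g] is what the induction needs at boxes. *)
Lemma std_of_eF_eval (psi : formula Var A) (w : M) (g : {g | rescaling g}) :
  @std_eval _ _ _ std_of_eF psi (w, g) = sval g (eF_eval psi w).
Proof.
rewrite /std_eval /eF_eval.
elim: psi w g => //= [psi IH|psi IH chi IH'|psi IH chi IH'|a psi IH] w g.
- by case: (proj2_sig g) => _ _ ->; rewrite IH.
- by rewrite IH IH' (rescaling_min _ _ (proj2_sig g)).
- by rewrite IH IH' (rescaling_goedel_imp _ _ (proj2_sig g)).
rewrite -inf_acc_rescaled => [|u]; last exact: eF_eval01.
by congr inf_acc; apply/funext => -[u h]; exact: IH.
Qed.

End FromEF.

(** * Equivalence of the two notions of validity *)

Theorem theorem3 (R : realType) (Var : countType) (A : finType)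
    (phi : formula Var A) :
  std_valid R phi <-> eF_valid R phi.
Proof.
split=> valid M w.
- by have := valid (std_of_eF M) (w, exist _ id rescaling_id); rewrite std_of_eF_eval.
- by rewrite -eF_of_std_eval; exact: valid.
Qed.
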